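(* For all $\Gamma\subseteq\{0,1\}^\infty$, $$\dim_P(\Gamma)=\inf \mathscr G_{\mathrm{str}}(\Gamma),$$ where $\mathscr G_{\mathrm{str}}(\Gamma)=\{s\in[0,\infty) : \text{there exists a learning function } l \text{ which strongly } s\text{-learns every } X\in\Gamma\}$.
   Context: $\dim_P$ denotes the (classical) packing dimension on the Cantor space $\{0,1\}^\infty$; equivalently, for $s\in[0,\infty)$ an $s$-gale is a function $d:\{0,1\}^*\to[0,\infty)$ with $d(w)2^{-s|w|}=d(w0)2^{-s(|w|+1)}+d(w1)2^{-s(|w|+1)}$ for all $w$, $d$ succeeds strongly on $X$ if $\liminf_n d(X\upharpoonright n)=\infty$, and $\dim_P(\Gamma)=\inf\{s: \text{some } s\text{-gale succeeds strongly on every } X\in\Gamma\}$. A learning function is a function $l:\{0,1\}^*\to\{0,1\}$ (yes $=1$, no $=0$). $Y\upharpoonright i$ is the length-$i$ prefix of $Y$; $\lambda$ is the uniform (Lebesgue) measure on $\{0,1\}^\infty$. For nonempty $w$, $\mathrm{AVG}_l(w)=\frac{1}{|w|}\sum_{i=0}^{|w|} l(w\upharpoonright i)$. For $s\ge0$, $l$ strongly $s$-learns $X$ iff (i) for all $n\in\mathbb N$, $\lambda(\{Y : \#\{i\in\mathbb N: l(Y\upharpoonright i)=1\}\ge n\})\le 2^{-n}$, and (ii) $\liminf_{n\to\infty}\mathrm{AVG}_l(X\upharpoonright n)\ge 1-s$ (no computability restriction on $l$). *)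

(* Defs.v *)
From HB Require Import structures.
From mathcomp Require Import all_boot all_order all_algebra.
From mathcomp Require Import all_classical all_reals all_analysis.
Set Implicit Arguments. Unset Strict Implicit. Unset Printing Implicit Defensive.
Import Order.TTheory GRing.Theory Num.Theory.
Local Open Scope classical_set_scope.
Local Open Scope ring_scope.

Definition cantor := nat -> bool.

Definition prefix (X : cantor) (n : nat) : seq bool := mkseq X n.

Section Defs.
Variable R : realType.

Definition is_gale (s : R) (d : seq bool -> R) : Prop :=
  (forall w, 0 <= d w) /\
  forall w : seq bool,
    d w * powR 2 (- s * (size w)%:R) =
      d (rcons w false) * powR 2 (- s * (size w).+1%:R)
    + d (rcons w true) * powR 2 (- s * (size w).+1%:R).

Definition succeeds_strongly (d : seq bool -> R) (X : cantor) : Prop :=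
  limn_einf (fun n => (d (prefix X n))%:E) = +oo%E.

(* classical packing dimension, via the gale characterization *)
Definition dimP (G : set cantor) : \bar R :=
  ereal_inf [set (s%:E) | s in [set s : R | 0 <= s /\
     exists d, is_gale s d /\ forall X, G X -> succeeds_strongly d X]].

Definition cylinder (w : seq bool) : set cantor :=
  [set Y | prefix Y (size w) = w].

(* uniform (Lebesgue) measure lambda on Cantor space, as the outer measure
   generated by cylinder covers (it agrees with lambda on measurable sets) *)
Definition lambda (A : set cantor) : \bar R :=
  ereal_inf [set x | exists w : nat -> seq bool,
     A `<=` \bigcup_k cylinder (w k) /\
     x = (\sum_(0 <= k <oo) ((2 : R) ^- (size (w k)))%:E)%E].

Definition learning_function := seq bool -> bool.

Definition AVG (l : learning_function) (w : seq bool) : R :=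
  (\sum_(0 <= i < (size w).+1) (l (take i w) : nat)%:R) / (size w)%:R.

Definition at_least_yes (l : learning_function) (n : nat) : set cantor :=
  [set Y | exists m, (n <= count (fun i => l (prefix Y i)) (iota 0 m))%N].

Definition strongly_learns (l : learning_function) (s : R) (X : cantor) : Prop :=
  (forall n : nat, (lambda (at_least_yes l n) <= ((2 : R) ^- n)%:E)%E) /\
  (((1 - s)%:E) <= limn_einf (fun n => (AVG l (prefix X n))%:E))%E.

Definition G_str (G : set cantor) : set R :=
  [set s | 0 <= s /\ exists l : learning_function,
     forall X, G X -> strongly_learns l s X].

End Defs.

(* Main.v *)
(** Dividing out the factor [2 ^ ((s - 1) |w|)] turns an [s]-gale into a martingale.
    A learner whose number of yes answers follows the binary logarithm of a martingale
    [m] satisfies the measure condition by Ville's inequality, and its average along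
    [X] is at least [1 - s] when the gale succeeds strongly on [X]. Conversely, cover
    the open set of sequences with at least [n] yes answers by cylinders of total
    measure at most [2 * 2 ^ -n]; the conditional measures of these covers, weighted by
    [a ^ n] with [a < 2], sum to a martingale that is at least [a ^ k] on words with
    [k] yes answers. As [a] approaches 2, this gives [s']-gales for every [s' > s]. *)

Require Import Defs.
From mathcomp Require Import all_boot all_order all_algebra.
From mathcomp Require Import all_classical all_reals all_analysis.
From mathcomp Require Import zify ring lra.
Import Defs Order.TTheory GRing.Theory Num.Theory.
Set Implicit Arguments. Unset Strict Implicit. Unset Printing Implicit Defensive.
Local Open Scope classical_set_scope.
Local Open Scope ring_scope.

(** * Prefixes of sequences and infinite paths of words *)

Lemma size_prefix (X : cantor) n : size (prefix X n) = n.
Proof. exact: size_mkseq. Qed.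

Lemma take_prefix (X : cantor) i n : (i <= n)%N -> take i (prefix X n) = prefix X i.
Proof. by move=> le_in; rewrite /prefix /mkseq -map_take take_iota (minn_idPl le_in). Qed.

(* [X] is read off the chain of words obtained by iterating the extension step from [w]. *)
Lemma extend_to_infinite (P : seq bool -> Prop) (w : seq bool) :
  P w -> (forall v, P v -> exists b, P (rcons v b)) ->
  exists X, prefix X (size w) = w /\ forall n, (size w <= n)%N -> P (prefix X n).
Proof.
move=> Pw step.
pose g v := if pselect (P (rcons v true)) then rcons v true else rcons v false.
pose f k := iter k g w.
have gE v : exists b, g v = rcons v b.
  by rewrite /g; case: pselect => ?; eexists.
have Pf k : P (f k).
  elim: k => //= k; rewrite -/(f k) /g; case: pselect => // nP Pfk.
  by have [[|] //] := step _ Pfk.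
have sz k : size (f k) = (size w + k)%N.
  elim: k => [|k IH]; first by rewrite addn0.
  by rewrite /f iterS -/(f k); have [b ->] := gE (f k); rewrite size_rcons IH addnS.
have take_f k j : (j <= k)%N -> take (size (f j)) (f k) = f j.
  elim: k => [|k IH]; first by rewrite leqn0 => /eqP->; rewrite take_size.
  rewrite leq_eqVlt ltnS => /orP[/eqP->|le_jk]; first by rewrite take_size.
  rewrite -[RHS](IH le_jk) /f iterS -/(f k); have [b ->] := gE (f k).
  rewrite -cats1 takel_cat // -[iter j g w]/(f j) !sz; lia.
pose X i := nth false (f i.+1) i.
have XE k : prefix X (size (f k)) = f k.
  apply: (@eq_from_nth _ false); rewrite size_prefix // => i lti.
  rewrite nth_mkseq // /X; case: (leqP i.+1 k) => [le|lt].
    by rewrite -(take_f _ _ le) nth_take // sz; lia.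
  by rewrite -[in RHS](@take_f i.+1 k) ?nth_take //; lia.
exists X; split; first exact: (XE 0).
move=> n len; have := Pf (n - size w)%N; rewrite -XE sz.
by congr (P (prefix X _)); lia.
Qed.

(** * Conditional probabilities of cylinders and Ville's inequality *)

Section Martingales.
Variable R : realType.
Implicit Types (u v w : seq bool).

(* The conditional probability of the cylinder of [u] given the cylinder of [w]. *)
Fixpoint cond_prob u w : R :=
  match u, w with
  | [::], _ => 1
  | _ :: _, [::] => 2 ^- size u
  | a :: u', b :: w' => (a == b)%:R * cond_prob u' w'
  end.

Lemma cond_prob_nil u : cond_prob u [::] = 2 ^- size u.
Proof. by case: u => //=; rewrite expr0 invr1. Qed.

Lemma cond_prob_ge0 u w : 0 <= cond_prob u w.
Proof.
elim: u w => [|a u IH] [|b w] //=.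
by rewrite mulr_ge0.
Qed.

Lemma cond_prob_martingale u w :
  cond_prob u (rcons w false) + cond_prob u (rcons w true) = 2 * cond_prob u w.
Proof.
elim: u w => [|a u IH] [|b w] /=; rewrite ?mulr1 //; last first.
  by rewrite -mulrDr IH mulrCA.
rewrite !cond_prob_nil exprS invfM mulrA divff ?pnatr_eq0 // mul1r.
by case: a => /=; rewrite mul0r mul1r ?addr0 ?add0r.
Qed.

Lemma cond_prob_long u w :
  (size u <= size w)%N -> cond_prob u w = (take (size u) w == u)%:R.
Proof.
elim: u w => [|a u IH] [|b w] //=.
by rewrite ltnS => /IH->; rewrite eqseq_cons eq_sym -natrM mulnb.
Qed.

Lemma cond_prob_neq0 u w :
  cond_prob u w != 0 -> take (size u) w = u \/ take (size w) u = w.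
Proof.
elim: u w => [|a u IH] [|b w] /=; rewrite ?take0; auto.
case: (eqVneq a b) => [->|]; rewrite ?mul0r ?eqxx // mul1r => /IH[->|->]; auto.
Qed.

(* The sum of the conditional probabilities of the words in [S] minus [m / c] is a
   martingale. Were it positive at the root, it would stay positive along an infinite
   path; but it is nonpositive on [S], and also at a word longer than all those involved
   that has no prefix in [S]. *)
Lemma kraft_ville (m : seq bool -> R) (S : set (seq bool)) (c : R) K :
  (forall w, 0 <= m w) ->
  (forall w, m (rcons w false) + m (rcons w true) = 2 * m w) ->
  0 < c -> (forall w, S w -> c <= m w) ->
  (forall u v, S u -> S v -> take (size u) v = u -> u = v) ->
  \sum_(0 <= k < K) oapp (fun u => if `[< S u >] then 2 ^- size u else 0) 0
      (pickle_inv k : option (seq bool)) <= m [::] / c.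
Proof.
move=> m0 mM c0 Sc anti.
pose T w k := oapp (fun u => if `[< S u >] then cond_prob u w else 0) 0
      (pickle_inv k : option (seq bool)).
pose D w := \sum_(0 <= k < K) T w k - m w / c.
suff : ~ (0 < D [::]).
  move/negP; rewrite -leNgt /D subr_le0; apply: le_trans.
  rewrite le_eqVlt; apply/orP; left; apply/eqP/eq_bigr => k _.
  by rewrite /T; case: pickle_inv => //= u; rewrite cond_prob_nil.
move=> D0.
have DM v : D (rcons v false) + D (rcons v true) = 2 * D v.
  rewrite /D addrACA -opprD -mulrDl mM -big_split /= mulrBr -mulrA; congr (_ - _).
  rewrite mulr_sumr; apply: eq_bigr => k _; rewrite /T.
  case: pickle_inv => [u|] /=; last by rewrite addr0 mulr0.
  by case: ifP => _; rewrite ?cond_prob_martingale // addr0 mulr0.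
have [|X [_ PX]] := @extend_to_infinite (fun w => 0 < D w) [::] D0.
  move=> v Dv; case: (ltP 0 (D (rcons v false))) => [h|h]; first by exists false.
  by exists true; have := DM v; lra.
have DS w : S w -> D w <= 0.
  move=> Sw; rewrite subr_le0; apply: (@le_trans _ _ 1); last first.
    by rewrite ler_pdivlMr // mul1r Sc.
  (* Since [S] is an antichain, the only word of [S] comparable with [w] is [w] itself; every other
     cylinder from [S] is disjoint from that of [w]. *)
  have T0 k : k != pickle w -> T w k = 0.
    move=> nk; rewrite /T; have := @pickle_invK (seq bool) k.
    case: pickle_inv => [u|] //= uk; case: asboolP => // Su.
    apply/eqP/negP => /negP /cond_prob_neq0 uw.
    suff uw' : u = w by rewrite -uk uw' eqxx in nk.
    by case: uw => [/anti->//|/anti<-].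
  have Tw : T w (pickle w) <= 1.
    rewrite /T pickleK_inv /=; case: asboolP => _ //.
    by rewrite cond_prob_long // take_size eqxx.
  rewrite big_mkord; case: (ltnP (pickle w) K) => [lt|ge].
    rewrite (bigD1 (Ordinal lt)) //= big1 ?addr0 // => i ni; apply: T0.
    by apply: contraNneq ni => h; apply/eqP/val_inj.
  rewrite big1 // => i _; apply: T0; rewrite neq_ltn; apply/orP; left.
  exact: leq_trans (ltn_ord i) ge.
(* Words coded below [K] have length at most [N], so at length [N] all conditional probabilities
   involved are 0 or 1. *)
pose N := (\max_(i < K) oapp size 0 (pickle_inv i : option (seq bool)))%N.
have := PX N (leq0n _); apply/negP; rewrite -leNgt.
case: (EM (exists2 n, (n <= N)%N & S (prefix X n))) => [[n nN Sn]|nS].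
  by have := le_lt_trans (DS _ Sn) (PX n (leq0n _)); rewrite ltxx.
rewrite subr_le0 big_mkord big1 ?divr_ge0 ?(ltW c0) // => i _.
rewrite /T; case E: pickle_inv => [u|] //=; case: asboolP => // Su.
have su : (size u <= N)%N.
  have := leq_bigmax (F := fun i : 'I_K => oapp size 0%N (pickle_inv i : option (seq bool))) i.
  by rewrite E.
rewrite cond_prob_long ?size_prefix //; case: eqP => // uE.
by exfalso; apply: nS; exists (size u) => //; rewrite -(take_prefix X su) uE.
Qed.

End Martingales.

(** * Lower limits and nonnegative series *)

Section Liminf.
Variable R : realType.
Implicit Types (u : (\bar R)^nat) (x : \bar R).

Lemma limn_einf_ge u x N :
  (forall n, (N <= n)%N -> (x <= u n)%E) -> (x <= limn_einf u)%E.
Proof.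
move=> H; rewrite limn_einf_lim (cvg_lim _ (@cvg_einfs_sup _ u)) //.
apply: (@le_trans _ _ (einfs u N)); last by apply: ereal_sup_ubound; exists N.
by apply: le_ereal_inf_tmp => _ [n /= Nn <-]; exact: H.
Qed.

Lemma lt_limn_einf u x :
  (x < limn_einf u)%E -> exists N, forall n, (N <= n)%N -> (x < u n)%E.
Proof.
rewrite limn_einf_lim (cvg_lim _ (@cvg_einfs_sup _ u)) //.
move=> /ereal_sup_gt [_ [N _ <-] xN]; exists N => n Nn.
by apply: lt_le_trans xN _; apply: ereal_inf_lbound; exists n.
Qed.

Lemma limn_einf_pinfty u :
  limn_einf u = +oo%E <-> forall A : R, exists N, forall n, (N <= n)%N -> (A%:E <= u n)%E.
Proof.
split=> [uy A|H].
  have [|N HN] := @lt_limn_einf u A%:E; first by rewrite uy ltry.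
  by exists N => n /HN/ltW.
by apply/eqyP => A _; have [N] := H A; exact: limn_einf_ge.
Qed.

Lemma nneseries_le u x :
  (forall k, 0 <= u k)%E -> (forall K, (\sum_(0 <= k < K) u k <= x)%E) ->
  (\sum_(0 <= k <oo) u k <= x)%E.
Proof.
move=> u0 ux; apply: lime_le; first by apply: is_cvg_nneseries => n _ _; exact: u0.
by apply: nearW => K; exact: ux.
Qed.

Lemma nneseries_ge_term u k : (forall i, 0 <= u i)%E -> (u k <= \sum_(0 <= i <oo) u i)%E.
Proof.
move=> u0; apply: le_trans (nneseries_lim_ge k.+1 _); last by move=> ? _ _; exact: u0.
by rewrite big_nat_recr //= leeDr // sume_ge0.
Qed.

Lemma sum_geometric_le (q : R) N : 0 <= q < 1 -> \sum_(0 <= n < N) q ^+ n <= (1 - q)^-1.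
Proof.
move=> /andP[q0 q1]; rewrite -[X in _ <= X]div1r ler_pdivlMr ?subr_gt0 // big_mkord.
have := subrX1 q N; have := exprn_ge0 N q0; nra.
Qed.

End Liminf.

(** * Counting yes answers *)

Section Yes.

Definition yes (l : learning_function) (w : seq bool) : nat :=
  (\sum_(0 <= i < (size w).+1) l (take i w))%N.

Lemma AVG_yes (R : realType) l w : AVG R l w = (yes l w)%:R / (size w)%:R.
Proof. by rewrite /AVG /yes natr_sum. Qed.

(** The empty prefix is also asked, so a word of length [m] receives [m.+1] answers. *)
Lemma yes_prefix l (Y : cantor) m :
  yes l (prefix Y m) = count (fun i => l (prefix Y i)) (iota 0 m.+1).
Proof.
rewrite /yes size_prefix -sum1_count /index_iota subn0 [RHS]big_mkcond /= !big_seq.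
by apply: eq_bigr => i; rewrite -[_ :: _]/(iota 0 m.+1) mem_iota add0n ltnS => /(take_prefix Y) ->; case: (l _).
Qed.

Lemma at_least_yesP l n Y :
  at_least_yes l n Y <-> exists m, (n <= yes l (prefix Y m))%N.
Proof.
split=> [[m nm]|[m nm]]; last by exists m.+1; rewrite -yes_prefix.
exists m; rewrite yes_prefix (leq_trans nm) //.
by rewrite -addn1 iotaD count_cat leq_addr.
Qed.

End Yes.

(** * The measure [lambda] and cylinder covers *)

Section Lambda.
Variable R : realType.

(* The padding by long words makes a possibly finite or empty family into a sequence
   without increasing the infimum. *)
Lemma lambda_le (A : set cantor) (w : nat -> option (seq bool)) (b : R) :
  (forall Y, A Y -> exists k u, w k = Some u /\ cylinder u Y) ->
  (forall K, \sum_(0 <= k < K) oapp (fun u => 2 ^- size u) 0 (w k) <= b) ->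
  (lambda R A <= b%:E)%E.
Proof.
move=> cov sumb; apply/lee_addgt0Pr => e e0.
have [j je] : exists j, (2 : R) ^- j < e.
  have [j _ /(_ j (leqnn j))] := near_infty_natSinv_expn_lt (PosNum e0).
  by move=> /= h; exists j; rewrite -div1r.
(* These lengths keep the total measure of the padding at most [2 ^- j], hence below [e]. *)
pose v k := odflt (nseq (j + k.+1) false) (w k).
have szv k : (2 : R) ^- size (v k) <=
    oapp (fun u => 2 ^- size u) 0 (w k) + 2 ^- j * 2^-1 * 2^-1 ^+ k.
  rewrite /v; case: (w k) => [u|] /=; rewrite ?lerDl ?mulr_ge0 ?exprn_ge0 ?invr_ge0 ?exprn_ge0 //.
  by rewrite size_nseq add0r exprD exprS !invfM exprVn mulrA.
apply: (@le_trans _ _ (\sum_(0 <= k <oo) ((2 : R) ^- size (v k))%:E)%E).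
  apply: ereal_inf_lbound; exists v; split=> // Y /cov [k [u [wk Yu]]].
  by exists k => //; rewrite /v wk.
apply: nneseries_le => [k|K]; first by rewrite lee_fin invr_ge0 exprn_ge0.
rewrite sumEFin lee_fin.
apply: (le_trans (ler_sum _ (fun k _ => szv k))); rewrite big_split /= -mulr_sumr.
apply: lerD; first exact: sumb.
apply: le_trans (ltW je); rewrite -mulrA ler_piMr ?invr_ge0 ?exprn_ge0 //.
have h : 0 <= (2^-1 : R) < 1 by apply/andP; split; lra.
have := sum_geometric_le K h; have -> : (1 - 2^-1 : R)^-1 = 2 by field.
lra.
Qed.

(** The infimum defining [lambda] need not be attained, hence the slack [b < c]. *)
Lemma cover_adherent (A : set cantor) (b c : R) :
  (lambda R A <= b%:E)%E -> b < c -> exists w : nat -> seq bool,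
    A `<=` \bigcup_k cylinder (w k) /\
    ((\sum_(0 <= k <oo) ((2 : R) ^- size (w k))%:E)%E <= c%:E)%E.
Proof.
move=> Ab bc; have /ereal_inf_lt [x [w [Aw ->]] xc] : (lambda R A < c%:E)%E.
  by apply: le_lt_trans Ab _; rewrite lte_fin.
by exists w; split=> //; exact: ltW.
Qed.

Lemma nneseries_martingale (f : nat -> seq bool -> \bar R) w :
  (forall k v, 0 <= f k v)%E ->
  (forall k v, (f k (rcons v false) + f k (rcons v true) = f k v + f k v)%E) ->
  (\sum_(0 <= k <oo) f k (rcons w false) + \sum_(0 <= k <oo) f k (rcons w true) =
   \sum_(0 <= k <oo) f k w + \sum_(0 <= k <oo) f k w)%E.
Proof.
move=> f0 fM; rewrite -!nneseriesD; try by move=> *; exact: f0.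
by apply: eq_eseriesr => k _; exact: fM.
Qed.

(** Overlaps are counted with multiplicity, so this only bounds the conditional measure of the union
    from above. The series may diverge, hence the extended real values. *)
Definition cover_prob (u : nat -> seq bool) (w : seq bool) : \bar R :=
  (\sum_(0 <= k <oo) (cond_prob R (u k) w)%:E)%E.

Lemma cover_prob_ge0 u w : (0 <= cover_prob u w)%E.
Proof. by apply: nneseries_ge0 => k _ _; rewrite lee_fin cond_prob_ge0. Qed.

Lemma cover_prob_martingale u w :
  (cover_prob u (rcons w false) + cover_prob u (rcons w true) =
   cover_prob u w + cover_prob u w)%E.
Proof.
apply: (@nneseries_martingale (fun k v => (cond_prob R (u k) v)%:E)) => k v.
  by rewrite lee_fin cond_prob_ge0.
by rewrite -!EFinD cond_prob_martingale mulr_natl mulr2n.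
Qed.

(* In place of compactness: if the value were below 1, it would stay so along an
   infinite path, but it is at least 1 once the path has entered a covering cylinder. *)
Lemma cover_prob_ge1 u w :
  cylinder w `<=` \bigcup_k cylinder (u k) -> (1 <= cover_prob u w)%E.
Proof.
move=> cov; rewrite leNgt; apply/negP => Mw.
have [|X [Xw PX]] := @extend_to_infinite (fun v => (cover_prob u v < 1)%E) w Mw.
  move=> v Mv; case: (ltP (cover_prob u (rcons v false)) 1%E) => [|h1]; first by exists false.
  case: (ltP (cover_prob u (rcons v true)) 1%E) => [|h2]; first by exists true.
  have := leeD h1 h2; rewrite cover_prob_martingale leNgt => /negP; case.
  exact: lteD.
have [k _ /= uk] := cov X Xw.
pose n := maxn (size w) (size (u k)).
have := PX n (leq_maxl _ _); apply/negP; rewrite -leNgt.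
apply: le_trans (@nneseries_ge_term _ _ k _); last by move=> i; rewrite lee_fin cond_prob_ge0.
have sz : (size (u k) <= n)%N by exact: leq_maxr.
by rewrite cond_prob_long ?size_prefix ?take_prefix ?uk ?eqxx.
Qed.

End Lambda.

(** * From a gale to a learner *)

Section GaleToLearner.
Variable R : realType.
Implicit Types (u v w : seq bool).

Lemma gale_martingale (s : R) d w :
  is_gale s d ->
  let m w := d w * 2 `^ (- s * (size w)%:R) * 2 ^+ size w in
  m (rcons w false) + m (rcons w true) = 2 * m w.
Proof.
by move=> [_ /(_ w) dw] m; rewrite /m !size_rcons -mulrDl -dw exprS; ring.
Qed.

Lemma martingale_gale (s : R) (m : seq bool -> R) :
  (forall w, 0 <= m w) ->
  (forall w, m (rcons w false) + m (rcons w true) = 2 * m w) ->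
  is_gale s (fun w => m w * 2 `^ ((s - 1) * (size w)%:R)).
Proof.
move=> m0 mM; split=> [w|w]; first by rewrite mulr_ge0 ?powR_ge0.
have E k : 2 `^ ((s - 1) * k%:R) * 2 `^ (- s * k%:R) = (2 : R) ^- k.
  rewrite -powRD; last by rewrite pnatr_eq0 implybT.
  by rewrite -mulrDl -(powR_invn k (ler0n _ 2)); congr (_ `^ _); ring.
rewrite !size_rcons -!mulrA !E -mulrDl mM exprS invfM.
by rewrite [2 * _]mulrC -!mulrA mulVKf ?pnatr_eq0.
Qed.

Lemma yes_rcons l w b : yes l (rcons w b) = (yes l w + l (rcons w b))%N.
Proof.
rewrite /yes size_rcons big_nat_recr //= [take _.+1 _]take_oversize ?size_rcons //.
congr (_ + _)%N; apply: eq_big_nat => i; rewrite ltnS => /andP[_ ile].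
by rewrite -cats1 takel_cat.
Qed.

(** The learner consults its own earlier answers; this counter over prefixes of length at most [k]
    breaks the circularity. The empty word gets the answer no. *)
Fixpoint greedy_count (m : seq bool -> R) w k : nat :=
  if k is k'.+1 then
    (greedy_count m w k' + (2 ^+ (greedy_count m w k').+1 * m [::] <= m (take k w))%R)%N
  else 0%N.

(* The answer is yes as soon as the capital has doubled once more often than has been
   announced so far. *)
Definition greedy (m : seq bool -> R) : learning_function := fun w =>
  if size w is k.+1 then 2 ^+ (greedy_count m w k).+1 * m [::] <= m w else false.

Lemma greedy_count_take m w j k :
  (k <= j)%N -> greedy_count m (take j w) k = greedy_count m w k.
Proof.
by elim: k => //= k IH kj; rewrite (IH (ltnW kj)) take_takel.
Qed.

Lemma greedy_count_rcons m w b :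
  greedy_count m (rcons w b) (size w) = greedy_count m w (size w).
Proof. by rewrite -(@greedy_count_take _ _ (size w)) // -cats1 take_size_cat. Qed.

Lemma yes_greedy m w : yes (greedy m) w = greedy_count m w (size w).
Proof.
elim/last_ind: w => [|w b IH]; first by rewrite /yes big_nat1 take0.
rewrite yes_rcons IH /greedy size_rcons /= greedy_count_rcons.
by rewrite [take _.+1 _]take_oversize // size_rcons.
Qed.

Lemma greedyE m w b :
  greedy m (rcons w b) = (2 ^+ (yes (greedy m) w).+1 * m [::] <= m (rcons w b)).
Proof. by rewrite yes_greedy {1}/greedy size_rcons greedy_count_rcons. Qed.

Lemma yes_nil m : yes (greedy m) [::] = 0%N.
Proof. by rewrite yes_greedy. Qed.

Section Martingale.
Variable m : seq bool -> R.
Hypotheses (m0 : forall w, 0 <= m w)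
  (mM : forall w, m (rcons w false) + m (rcons w true) = 2 * m w)
  (mpos : 0 < m [::]).

(** One step at most doubles a nonnegative martingale, so one yes per step suffices to keep up with
    the doublings. *)
Lemma martingale_lt_greedy w : m w < 2 ^+ (yes (greedy m) w).+1 * m [::].
Proof.
elim/last_ind: w => [|w b IH]; first by rewrite yes_nil expr1 mulr_natl mulr2n ltrDl.
have mb : m (rcons w b) <= 2 * m w.
  by rewrite -mM; case: b; rewrite ?lerDl ?lerDr.
rewrite yes_rcons greedyE; case: (leP (2 ^+ (yes (greedy m) w).+1 * _)) => [_|]; last by rewrite /= addn0.
by rewrite /= addn1 exprS -mulrA (le_lt_trans mb) // ltr_pM2l.
Qed.

(** Minimality makes this an antichain, as [kraft_ville] requires, while its cylinders still cover
    [at_least_yes (greedy m) n]. *)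
Definition first_yes n : set (seq bool) := [set w |
  (n <= yes (greedy m) w)%N /\
  forall j, (j < size w)%N -> (yes (greedy m) (take j w) < n)%N].

(** By minimality the last letter of a nonempty such word brings the [n]-th yes, and that answer
    certifies the capital. *)
Lemma first_yes_martingale n w : first_yes n w -> 2 ^+ n * m [::] <= m w.
Proof.
elim/last_ind: w => [|w b _] [].
  by rewrite yes_nil leqn0 => /eqP-> _; rewrite mul1r.
rewrite yes_rcons greedyE => nyes /(_ (size w)).
rewrite size_rcons -cats1 take_size_cat // ltnSn => /(_ isT) yesn.
move: nyes; rewrite -cats1; case: leP => [h|_]; last by rewrite /= addn0 leqNgt yesn.
by rewrite /= addn1 => nyes; rewrite (_ : n = (yes (greedy m) w).+1) //; lia.
Qed.

Lemma lambda_greedy n : (lambda R (at_least_yes (greedy m) n) <= (2 ^- n)%:E)%E.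
Proof.
pose w k := if (pickle_inv k : option (seq bool)) is Some u then
  if `[< first_yes n u >] then Some u else None else None.
apply: (@lambda_le _ _ w) => [Y /at_least_yesP ex|K].
  have [j nj minj] := ex_minnP ex.
  exists (pickle (prefix Y j)), (prefix Y j); split; last by rewrite /cylinder /= size_prefix.
  rewrite /w pickleK_inv asboolT //; split=> // i; rewrite size_prefix => ij.
  rewrite take_prefix; last exact: ltnW.
  by rewrite ltnNge; apply/negP => /minj; rewrite leqNgt ij.
have -> : (2 : R) ^- n = m [::] / (2 ^+ n * m [::]).
  by rewrite invfM mulrCA divff ?mulr1 // gt_eqF.
apply: le_trans (@kraft_ville R m (first_yes n) _ K m0 mM _ _ _).
- apply: ler_sum => k _; rewrite /w; case: pickle_inv => //= u.
  by case: asboolP.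
- by rewrite mulr_gt0 // exprn_gt0.
- exact: first_yes_martingale.
move=> u v [nu _] [_ vn] uv; have [lt|ge] := ltnP (size u) (size v).
  by have := vn _ lt; rewrite uv ltnNge nu.
by rewrite -uv take_oversize.
Qed.

End Martingale.

Lemma gale_learner (s : R) (d : seq bool -> R) :
  is_gale s d -> exists l : learning_function,
    forall X, succeeds_strongly d X -> strongly_learns l s X.
Proof.
move=> gd; have [d0 _] := gd.
pose m w := d w * 2 `^ (- s * (size w)%:R) * 2 ^+ size w.
have m0 w : 0 <= m w by rewrite !mulr_ge0 ?powR_ge0 ?exprn_ge0.
have mM w : m (rcons w false) + m (rcons w true) = 2 * m w by exact: gale_martingale.
have mE w : m w = d w * 2 `^ ((1 - s) * (size w)%:R).
  rewrite /m -mulrA -powR_mulrn // -powRD; last by rewrite pnatr_eq0 implybT.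
  by congr (_ * _ `^ _); ring.
exists (greedy m) => X /limn_einf_pinfty dX.
(* With zero initial capital the martingale would vanish on every word, contradicting success on
   [X]. *)
have mpos : 0 < m [::].
  rewrite lt_def m0 andbT; apply/eqP => mnil.
  have mz w : m w = 0.
    elim/last_ind: w => // w b IH.
    have := mM w; rewrite IH mulr0; have := m0 (rcons w false); have := m0 (rcons w true).
    case: b; lra.
  have [N /(_ N (leqnn N))] := dX 1; rewrite lee_fin => d1.
  have := mz (prefix X N); rewrite mE => /eqP; rewrite mulf_eq0.
  by rewrite gt_eqF ?gt_eqF ?powR_gt0 // (lt_le_trans _ d1).
split; first exact: lambda_greedy.
(* This threshold absorbs the factor [2 * m [::]] of [martingale_lt_greedy], leaving
   [2 ^ ((1 - s) n) < 2 ^ yes]. *)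
have [N HN] := dX (2 * m [::]).
apply: (@limn_einf_ge _ _ _ N.+1) => n Nn; rewrite lee_fin AVG_yes size_prefix.
have n0 : 0 < n%:R :> R by rewrite ltr0n; lia.
rewrite ler_pdivlMr // leNgt; apply/negP => /ltW yesn.
have := martingale_lt_greedy m0 mM mpos (prefix X n); rewrite mE size_prefix.
apply/negP; rewrite -leNgt exprS -mulrA mulrCA mulrC.
apply: ler_pM; rewrite ?exprn_ge0 ?mulr_ge0 //.
- by have := HN n (ltnW Nn); rewrite lee_fin.
by rewrite -powR_mulrn // ler_powR // ler1n.
Qed.

End GaleToLearner.

(** * From a learner to gales *)

Section LearnerToGale.
Variable R : realType.

Lemma powR2_unbounded (g A : R) :
  0 < g -> exists N, forall n, (N <= n)%N -> A <= 2 `^ (g * n%:R).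
Proof.
move=> g0; have ln2 : 0 < ln (2 : R) by rewrite ln_gt0 // ltr1n.
have gl : 0 < g * ln 2 by rewrite mulr_gt0.
exists (Num.bound `|A / (g * ln 2)|) => n Nn.
rewrite /powR pnatr_eq0 /=; apply: le_trans (expR_ge1Dx _).
have h : A / (g * ln 2) <= n%:R.
  apply: le_trans (ler_norm _) _; apply: ltW.
  by apply: lt_le_trans (archi_boundP (normr_ge0 _)) _; rewrite ler_nat.
move: h; rewrite ler_pdivrMr // => h.
by apply: le_trans h _; rewrite mulrA [n%:R * g]mulrC lerDr.
Qed.

(** The constant martingale 1 already yields a gale growing like [2 ^ ((s - 1) n)]. *)
Lemma gale_large (s : R) (G : set cantor) : 1 < s ->
  exists d, is_gale s d /\ forall X, G X -> succeeds_strongly d X.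
Proof.
move=> s1; exists (fun w => 1 * 2 `^ ((s - 1) * (size w)%:R)); split.
  by apply: (@martingale_gale _ _ (fun=> 1)) => // w; lra.
move=> X _; apply/limn_einf_pinfty => A.
have [|N HN] := @powR2_unbounded (s - 1) A; first by rewrite subr_gt0.
by exists N => n /HN; rewrite lee_fin mul1r size_prefix.
Qed.

Lemma learner_martingale (l : learning_function) (a : R) : 0 <= a < 2 ->
  (forall n, (lambda R (at_least_yes l n) <= (2 ^- n)%:E)%E) ->
  exists m : seq bool -> R, [/\ forall w, 0 <= m w,
    forall w, m (rcons w false) + m (rcons w true) = 2 * m w
    & forall w, a ^+ yes l w <= m w].
Proof.
move=> /andP[a0 a2] laml.
have /choice [u Hu] n : exists u : nat -> seq bool,
    at_least_yes l n `<=` \bigcup_k cylinder (u k) /\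
    ((\sum_(0 <= k <oo) ((2 : R) ^- size (u k))%:E)%E <= (2 * 2 ^- n)%:E)%E.
  apply: cover_adherent (laml n) _.
  by rewrite mulr_natl mulr2n ltrDl invr_gt0 exprn_gt0.
pose f n w := ((a ^+ n)%:E * cover_prob R (u n) w)%E.
have f0 n w : (0 <= f n w)%E.
  by rewrite mule_ge0 ?cover_prob_ge0 // lee_fin exprn_ge0.
pose M w := (\sum_(0 <= n <oo) f n w)%E.
have M0 w : (0 <= M w)%E by apply: nneseries_ge0 => n _ _; exact: f0.
have MM w : (M (rcons w false) + M (rcons w true) = M w + M w)%E.
  apply: nneseries_martingale => // n v.
  by rewrite /f -!ge0_muleDr ?cover_prob_ge0 // cover_prob_martingale.
have q01 : 0 <= a / 2 < 1 by apply/andP; split; lra.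
(* The [n]-th cover contributes at most [a ^ n * 2 * 2 ^- n] at the root, a geometric series because
   [a < 2]. *)
have Mnil : (M [::] < +oo)%E.
  apply: (@le_lt_trans _ _ (2 * (1 - a / 2)^-1)%:E); last exact: ltry.
  apply: nneseries_le => // K.
  apply: (@le_trans _ _ (\sum_(0 <= n < K) (2 * (a / 2) ^+ n)%:E)%E).
    apply: lee_sum => n _; have [_ Hn] := Hu n.
    apply: (@le_trans _ _ ((a ^+ n)%:E * (2 * 2 ^- n)%:E)%E).
      apply: lee_wpmul2l; first by rewrite lee_fin exprn_ge0.
      apply: le_trans Hn; rewrite le_eqVlt; apply/orP; left; apply/eqP.
      by apply: eq_eseriesr => k _; rewrite cond_prob_nil.
    by rewrite -EFinM lee_fin expr_div_n mulrCA.
  by rewrite sumEFin lee_fin -mulr_sumr ler_pM2l // sum_geometric_le.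
(* Finiteness spreads from the root, since each step at most doubles [M]. *)
have Mfin w : (M w < +oo)%E.
  elim/last_ind: w => // w b IH.
  have h : (M (rcons w b) <= M w + M w)%E.
    by rewrite -MM; case: b; rewrite ?leeDl ?leeDr.
  by apply: le_lt_trans h _; rewrite lte_add_pinfty.
have Mnum w : M w \is a fin_num by rewrite ge0_fin_numE.
exists (fun w => fine (M w)); split=> w; first by rewrite fine_ge0.
  by rewrite -fineD // MM fineD // mulr_natl mulr2n.
rewrite -lee_fin fineK //.
(* The term indexed by [yes l w] suffices: every extension of [w] has at least that many yes
   answers, so that cover contains the whole cylinder. *)
apply: le_trans (@nneseries_ge_term _ _ (yes l w) _) => //.
rewrite /f lee_pemulr ?lee_fin ?exprn_ge0 //; apply: cover_prob_ge1 => Y Yw.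
by have [cov _] := Hu (yes l w); apply/cov/at_least_yesP; exists (size w); rewrite Yw.
Qed.

Lemma learner_gale (l : learning_function) (s s' : R) : 0 <= s -> s < s' -> s' <= 1 ->
  (forall n, (lambda R (at_least_yes l n) <= (2 ^- n)%:E)%E) ->
  exists d, is_gale s' d /\ forall X, strongly_learns l s X -> succeeds_strongly d X.
Proof.
(* The gap [del] pays [del / 4] for the base [2 ^ b < 2] and [del / 4] for the average; the exponent
   of the gale still grows at rate at least [del / 4]. The bound [s' <= 1] makes [b] positive. *)
move=> s0 ss' s'1 laml; pose del := s' - s; pose b := 1 - del / 4.
have a02 : 0 <= (2 : R) `^ b < 2.
  rewrite powR_ge0 /= -[ltRHS](powRr1 (ler0n R 2)) /powR pnatr_eq0 /= ltr_expR.
  by rewrite ltr_pM2r ?ln_gt0 ?ltr1n // /b /del; lra.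
have [m [m0 mM ma]] := learner_martingale a02 laml.
exists (fun w => m w * 2 `^ ((s' - 1) * (size w)%:R)); split.
  exact: martingale_gale.
move=> X [_ avgX]; apply/limn_einf_pinfty => A.
have [|N1 HN1] := @lt_limn_einf _ (fun n => (AVG R l (prefix X n))%:E) (1 - s - del / 4)%:E.
  by apply: lt_le_trans avgX; rewrite lte_fin /del; lra.
have [|N2 HN2] := @powR2_unbounded (del / 4) A; first by rewrite /del; lra.
exists (N1 + N2).+1 => n Nn; rewrite lee_fin size_prefix.
have n0 : 0 < n%:R :> R by rewrite ltr0n; lia.
have /HN1 : (N1 <= n)%N by lia.
rewrite lte_fin AVG_yes size_prefix ltr_pdivlMr // => yesn.
apply: le_trans (HN2 n _) _; first by lia.
apply: (@le_trans _ _ ((2 `^ b) ^+ yes l (prefix X n) * 2 `^ ((s' - 1) * n%:R))); last first.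
  by rewrite ler_wpM2r ?powR_ge0.
rewrite -powR_mulrn ?powR_ge0 // -powRrM -powRD; last by rewrite pnatr_eq0 implybT.
rewrite ler_powR ?ler1n //.
set y := (yes l _)%:R in yesn *.
have b0 : 0 < b by rewrite /b /del; lra.
have h1 : b * ((1 - s - del / 4) * n%:R) <= b * y by rewrite ler_pM2l // ltW.
apply: (@le_trans _ _ (b * ((1 - s - del / 4) * n%:R) + (s' - 1) * n%:R)); last by rewrite lerD2r.
rewrite mulrA -mulrDl ler_pM2r // /b /del; nra.
Qed.

End LearnerToGale.

(** * Both inequalities between the infima *)

Theorem mainTheorem8 (R : realType) (G : set cantor) :
  dimP R G = ereal_inf [set (s%:E) | s in G_str G].
Proof.
apply/eqP; rewrite eq_le; apply/andP; split; last first.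
  apply: ereal_inf_le_tmp => _ [s [s0 [d [gd dG]]] <-]; exists s => //.
  split=> //; have [l lX] := gale_learner gd.
  by exists l => X GX; exact/lX/dG.
apply: le_ereal_inf_tmp => _ [s [s0 [l lG]] <-]; apply/lee_addgt0Pr => e e0.
rewrite -EFinD; apply: ereal_inf_lbound; exists (s + e) => //; split; first by lra.
have [s1|s1] := ltP 1 (s + e); first exact: gale_large.
(* The measure condition on [l] is available only through a member of [G]; for empty [G] any gale
   will do. *)
have [[X GX]|nG] := EM (exists X, G X).
  have [|d [gd dG]] := @learner_gale R l s (s + e) s0 _ s1 (lG X GX).1; first by lra.
  by exists d; split=> // Y GY; exact/dG/lG.
exists (fun w => 1 * 2 `^ ((s + e - 1) * (size w)%:R)); split=> [|X GX].
  by apply: (@martingale_gale _ _ (fun=> 1)) => // w; lra.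
by case: nG; exists X.
Qed.
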